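(* Suppose that a group $G$ acts geometrically on two CAT(0) spaces $X$ and $Y$. Let $x_0\in X$ and $y_0\in Y$. The following are equivalent. (1) For any sequence $\{g_i\mid i\in\mathbb{N}\}\subset G$, the sequence $\{g_ix_0\mid i\in\mathbb{N}\}$ is a Cauchy sequence in $X\cup\partial X$ if and only if the sequence $\{g_iy_0\mid i\in\mathbb{N}\}$ is a Cauchy sequence in $Y\cup\partial Y$. (2) There exists a $G$-equivariant homeomorphism $\bar\phi:\partial X\to\partial Y$ of the boundaries which is a continuous extension of the quasi-isometry $\phi:Gx_0\to Gy_0$ defined by $\phi(gx_0)=gy_0$.
   Context: A CAT(0) space is a proper geodesic metric space satisfying the CAT(0)-inequality for all geodesic triangles. A geometric action is an action by isometries that is proper (each point $x$ has some $r>0$ such that $\{g : gB(x,r)\cap B(x,r)\ne\emptyset\}$ is finite) and cocompact. $B(x,r)$ is the closed ball of radius $r$ about $x$. The boundary $\partial X$ is the set of geodesic rays in $X$ modulo the relation that $\xi\sim\zeta$ iff the image of $\xi$ lies in a bounded neighbourhood of the image of $\zeta$. $X\cup\partial X$ carries the usual (cone) topology: $X$ is open, and for $\alpha\in\partial X$ with $\xi_\alpha$ the ray from $x_0$ to $\alpha$, and any fixed $\epsilon_0>0$, the sets $U(\alpha;r,\epsilon_0)=\{x\in X\cup\partial X : x\notin B(x_0,r),\ d_X(\xi_\alpha(r),\xi_x(r))<\epsilon_0\}$, $r>0$, form a neighbourhood basis at $\alpha$, where $\xi_x$ is the geodesic segment or ray from $x_0$ to $x$. The topology does not depend on $x_0$.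 $G$ acts on $\partial X$ by homeomorphisms induced from its action on geodesic rays. Cauchy sequences: an unbounded sequence $\{x_i\mid i\in\mathbb{N}\}\subset X$ is a Cauchy sequence in $X\cup\partial X$ if there exists $\epsilon_0>0$ such that for any $r>0$ there is $i_0\in\mathbb{N}$ with $x_i\in U(x_{i_0};r,\epsilon_0)$ for all $i\ge i_0$, where $U(x_{i_0};r,\epsilon_0)=\{x\in X : x\notin B(x_0,r),\ d_X(\xi_{x_{i_0}}(r),\xi_x(r))<\epsilon_0\}$ and $\xi_z$ is the geodesic segment from $x_0$ to $z$. (Only unbounded sequences can be Cauchy in this sense.) The same definition is used in $Y$ with basepoint $y_0$. A map $\bar\phi:\partial X\to\partial Y$ is a continuous extension of $\phi:gx_0\mapsto gy_0$ if, whenever $\{g_i\}\subset G$ is a sequence such that $g_ix_0$ converges to $\alpha\in\partial X$ in $X\cup\partial X$, the sequence $g_iy_0$ converges to $\bar\phi(\alpha)$ in $Y\cup\partial Y$ (and $\bar\phi$ is continuous). *)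

(* Defs.v *)
From HB Require Import structures.
From mathcomp Require Import all_boot all_order all_algebra.
From mathcomp Require Import ring lra.
From mathcomp Require Import all_classical all_reals all_analysis.

Set Implicit Arguments.
Unset Strict Implicit.
Unset Printing Implicit Defensive.

Import Order.TTheory GRing.Theory Num.Theory.
Import numFieldNormedType.Exports.

Local Open Scope classical_set_scope.
Local Open Scope ring_scope.

Section Geodesics.
Context {R : realType} {T : Type} (d : T -> T -> R).

(* Maps out of a real interval are total functions on R; only their values on
   the interval (here [0, d x y]) are constrained or used. *)
Definition is_geodesic (x y : T) (c : R -> T) : Prop :=
  [/\ c 0 = x, c (d x y) = y &
      forall s t, 0 <= s <= d x y -> 0 <= t <= d x y -> d (c s) (c t) = `|s - t|].

(* The i-th side c i joins the vertex p i to the next one cyclically. *)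
Definition is_geodesic_triangle (p : 'I_3 -> T) (c : 'I_3 -> R -> T) : Prop :=
  forall i, is_geodesic (p i) (p (ordS i)) (c i).

End Geodesics.

(* The library norm on R * R and on 'rV[R]_2 is the sup norm, hence this
   explicit Euclidean distance. *)
Definition euclid {R : realType} (u v : R * R) : R :=
  Num.sqrt ((u.1 - v.1) ^+ 2 + (u.2 - v.2) ^+ 2).

(* A comparison triangle is a geodesic triangle of the Euclidean plane with the
   same side lengths; the comparison point of c i s is c' i s. *)
Definition CAT0_inequality {R : realType} (T : Type) (d : T -> T -> R) : Prop :=
  forall (p : 'I_3 -> T) (c : 'I_3 -> R -> T)
         (p' : 'I_3 -> R * R) (c' : 'I_3 -> R -> R * R),
    is_geodesic_triangle d p c ->
    is_geodesic_triangle euclid p' c' ->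
    (forall i, euclid (p' i) (p' (ordS i)) = d (p i) (p (ordS i))) ->
    forall (i j : 'I_3) (s t : R),
      0 <= s <= d (p i) (p (ordS i)) -> 0 <= t <= d (p j) (p (ordS j)) ->
      d (c i s) (c j t) <= euclid (c' i s) (c' j t).

(* [closed_ball] of the library is the closure of the open ball. *)
Definition cball {R : realType} {X : metricType R} (x : X) (r : R) : set X :=
  [set y | mdist x y <= r].

HB.mixin Record Metric_isCAT0 (R : realType) X & Metric R X := {
  cat0_proper : forall (x : X) (r : R), compact (cball x r) ;
  cat0_geodesic : forall x y : X, exists c, is_geodesic mdist x y c ;
  cat0_comparison : CAT0_inequality (@mdist R X)
}.

#[short(type="cat0Type")]
HB.structure Definition CAT0 (R : realType) :=
  { X of Metric R X & Metric_isCAT0 R X }.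

Section Rays.
Context {R : realType} (X : metricType R).

Record ray := Ray {
  ray_fun :> R -> X ;
  ray_isometric : forall s t, 0 <= s -> 0 <= t ->
    mdist (ray_fun s) (ray_fun t) = `|s - t| }.

HB.instance Definition _ := gen_eqMixin ray.
HB.instance Definition _ := gen_choiceMixin ray.

Definition asymptotic (xi zeta : ray) : Prop :=
  exists C : R, forall s, 0 <= s ->
    exists2 t, 0 <= t & mdist (xi s) (zeta t) <= C.

Lemma asymptotic_refl xi : asymptotic xi xi.
Proof. by exists 0 => s s0; exists s => //; rewrite mdistxx. Qed.

Lemma asymptotic_sym xi zeta : asymptotic xi zeta -> asymptotic zeta xi.
Proof.
move=> [C xiC]; exists (C + (mdist (xi 0) (zeta 0) + C)) => s s0.
exists s => //.
have [t t0 tC] := xiC _ s0.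
have st : `|s - t| <= mdist (xi 0) (zeta 0) + C.
  have e1 : mdist (xi 0) (xi s) = s.
    by rewrite ray_isometric// sub0r normrN ger0_norm.
  have e2 : mdist (zeta 0) (zeta t) = t.
    by rewrite ray_isometric// sub0r normrN ger0_norm.
  have := metric_triangle (xi 0) (zeta 0) (xi s).
  have := metric_triangle (zeta 0) (zeta t) (xi s).
  have := metric_triangle (zeta 0) (xi 0) (zeta t).
  have := metric_triangle (xi 0) (xi s) (zeta t).
  rewrite e1 e2 (metric_sym (zeta t) (xi s)) (metric_sym (zeta 0) (xi 0)).
  by move=> ? ? ? ?; rewrite ler_norml; apply/andP; split; lra.
have := metric_triangle (zeta s) (zeta t) (xi s).
rewrite ray_isometric// (metric_sym (zeta t)) => h.
by apply: (le_trans h); rewrite addrC lerD.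
Qed.

Lemma asymptotic_trans xi zeta eta :
  asymptotic xi zeta -> asymptotic zeta eta -> asymptotic xi eta.
Proof.
move=> [C xC] [D zD]; exists (C + D) => s s0.
have [t t0 tC] := xC _ s0; have [u u0 uD] := zD _ t0.
exists u => //; apply: le_trans (metric_triangle _ (zeta t) _) _.
exact: lerD.
Qed.

Let asymptoticb (xi zeta : ray) : bool := `[< asymptotic xi zeta >].

Let asymptoticb_refl : reflexive asymptoticb.
Proof. by move=> xi; apply/asboolP; exact: asymptotic_refl. Qed.

Let asymptoticb_sym : symmetric asymptoticb.
Proof. by move=> xi zeta; apply/asboolP/asboolP; exact: asymptotic_sym. Qed.

Let asymptoticb_trans : transitive asymptoticb.
Proof.
by move=> x y z /asboolP xy /asboolP yz; apply/asboolP; exact: asymptotic_trans yz.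
Qed.

Canonical asymptotic_rel :=
  EquivRel asymptoticb asymptoticb_refl asymptoticb_sym asymptoticb_trans.

Local Open Scope quotient_scope.

Definition boundary : Type := {eq_quot asymptotic_rel}.
HB.instance Definition _ := Choice.on boundary.
HB.instance Definition _ := EqQuotient.on boundary.

Definition endpoint (xi : ray) : boundary := \pi_boundary xi.

Lemma endpointP xi zeta : endpoint xi = endpoint zeta <-> asymptotic xi zeta.
Proof.
by split=> [/eqquotP/asboolP//|h]; apply/eqquotP/asboolP.
Qed.

(* [c] is "the" geodesic segment or ray from x0 to z, unique in a CAT(0) space. *)
Definition geodesic_to (x0 : X) (z : X + boundary) (c : R -> X) : Prop :=
  match z with
  | inl x => is_geodesic mdist x0 x c
  | inr alpha => exists xi : ray, [/\ c = xi, xi 0 = x0 & endpoint xi = alpha]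
  end.

(* U(z; r, e) for a centre z in X or in the boundary. *)
Definition cone_nbhd (x0 : X) (z : X + boundary) (r e : R) : set (X + boundary) :=
  [set w | ~ (inl @` cball x0 r) w /\
     exists c c', [/\ geodesic_to x0 z c, geodesic_to x0 w c' &
                      mdist (c r) (c' r) < e]].

(* Membership of [inl (x i0)] itself, at i = i0, forces d(x0, x i0) > r, so
   that the geodesic from x0 to x i0 is only evaluated inside its domain. *)
Definition cone_cauchy (x0 : X) (x : nat -> X) : Prop :=
  ~ (exists M : R, forall i, mdist x0 (x i) <= M) /\
  exists2 e : R, 0 < e & forall r, 0 < r ->
    exists i0, forall i, (i0 <= i)%N ->
      cone_nbhd x0 (inl (x i0)) r e (inl (x i)).

(* X together with its boundary; the phantom basepoint x0 is the one used to
   define the cone topology. *)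
Definition bordification (x0 : X) : Type := (X + boundary)%type.
HB.instance Definition _ (x0 : X) := Choice.on (bordification x0).

(* The scale e is immaterial: for each fixed e > 0 the sets U(alpha; r, e),
   r > 0, form a neighbourhood basis at alpha. *)
Definition cone_open (x0 : X) : set_system (bordification x0) :=
  [set A | open (inl @^-1` A : set X) /\
     forall alpha, A (inr alpha) -> forall e : R, 0 < e ->
       exists2 r : R, 0 < r & cone_nbhd x0 (inr alpha) r e `<=` A].

End Rays.

Arguments ray {R} X.
Arguments boundary {R} X.

Section ConeTopology.
Context {R : realType} {X : cat0Type R}.

Let fan (s : R) (t : R) (c c' : R -> X) :
  0 <= s <= t -> c 0 = c' 0 ->
  (forall u v, 0 <= u <= t -> 0 <= v <= t -> mdist (c u) (c v) = `|u - v|) ->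
  (forall u v, 0 <= u <= t -> 0 <= v <= t -> mdist (c' u) (c' v) = `|u - v|) ->
  mdist (c s) (c' s) <= mdist (c t) (c' t).
Proof.
move=> /andP[s0 st] c0 cI c'I; have t0 : 0 <= t by exact: le_trans st.
have [->//|tn0] := eqVneq s t.
have tp : 0 < t by rewrite (le_lt_trans s0)// lt_neqAle tn0 st.
have itv0 : 0 <= (0 : R) <= t by rewrite lexx t0.
have itvt : 0 <= t <= t by rewrite lexx t0.
set D := mdist (c t) (c' t).
have D0 : 0 <= D by exact: mdist_ge0.
have cl u : 0 <= u <= t -> mdist (c 0) (c u) = u.
  by move=> ut; rewrite cI// sub0r normrN ger0_norm//; case/andP: ut.
have c'l u : 0 <= u <= t -> mdist (c' 0) (c' u) = u.
  by move=> ut; rewrite c'I// sub0r normrN ger0_norm//; case/andP: ut.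
have Dt : D <= t + t.
  apply: le_trans (metric_triangle _ (c 0) _) _.
  by rewrite (metric_sym _ (c 0)) cl// {1}c0 c'l.
pose h := Num.sqrt (t ^+ 2 - (D / 2) ^+ 2).
have h2 : h ^+ 2 = t ^+ 2 - (D / 2) ^+ 2.
  by rewrite sqr_sqrtr// subr_ge0 lerXn2r ?nnegrE ?divr_ge0//; lra.
pose p i : X := tnth [tuple c 0; c t; c' t] i.
have [b bE] := cat0_geodesic (c t) (c' t).
pose k (i : 'I_3) (u : R) : X :=
  tnth [tuple c u; b u; c' (t - u)] i.
pose p' i : R * R := tnth [tuple (0, h); (- (D / 2), 0); (D / 2, 0)] i.
pose k' (i : 'I_3) (u : R) : R * R :=
  tnth [tuple (- (D / 2) * (u / t), h * (1 - u / t));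
              (u - D / 2, 0);
              (D / 2 * (1 - u / t), h * (u / t))] i.
have sqrtE (a q : R) : 0 <= a -> q = a ^+ 2 -> Num.sqrt q = a.
  by move=> a0 ->; rewrite sqrtr_sqr ger0_norm.
have tn : t != 0 by rewrite gt_eqF.
have oS0 : ordS (ord0 : 'I_3) = @Ordinal 3 1 isT by exact: val_inj.
have oS1 : ordS (@Ordinal 3 1 isT) = @Ordinal 3 2 isT by exact: val_inj.
have oS2 : ordS (@Ordinal 3 2 isT) = (ord0 : 'I_3) by exact: val_inj.
have I3 (P : 'I_3 -> Prop) : P ord0 -> P (@Ordinal 3 1 isT) ->
    P (@Ordinal 3 2 isT) -> forall i, P i.
  move=> P0 P1 P2 [[|[|[|//]]] i3].
  - by rewrite (_ : Ordinal i3 = ord0)//; exact: val_inj.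
  - by rewrite (_ : Ordinal i3 = @Ordinal 3 1 isT)//; exact: val_inj.
  - by rewrite (_ : Ordinal i3 = @Ordinal 3 2 isT)//; exact: val_inj.
have tri : is_geodesic_triangle mdist p k.
  apply: I3; rewrite ?oS0 ?oS1 ?oS2 /p /k /tnth /=.
  - by rewrite /is_geodesic cl.
  - exact: bE.
  - rewrite /is_geodesic c0 metric_sym c'l// subr0 subrr; split=> // u v /andP[u0 ut] /andP[v0 vt].
    rewrite c'I; [|by apply/andP; split; lra..].
    by rewrite -normrN; congr (`| _ |); ring.
have len i : euclid (p' i) (p' (ordS i)) = mdist (p i) (p (ordS i)).
  move: i; apply: I3; rewrite ?oS0 ?oS1 ?oS2 /p /p' /tnth /euclid /=.
  - by rewrite cl//; apply: sqrtE => //; rewrite subr0 h2; ring.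
  - by rewrite -/D; apply: sqrtE => //; field.
  - by rewrite c0 metric_sym c'l//; apply: sqrtE => //; rewrite sub0r sqrrN h2; ring.
have tri' : is_geodesic_triangle euclid p' k'.
  move=> i; rewrite /is_geodesic len; move: i.
  apply: I3; rewrite ?oS0 ?oS1 ?oS2 /p /p' /k' /tnth /=.
  - rewrite cl//; split; first by congr pair; field.
      by congr pair; field.
    move=> u v _ _; rewrite /euclid /=; apply: sqrtE => //.
    transitivity (((u - v) / t) ^+ 2 * ((D / 2) ^+ 2 + h ^+ 2)); first by field.
    by rewrite h2 real_normK ?num_real//; field.
  - rewrite -/D; split; first by congr pair; ring.
      by congr pair; field.
    move=> u v _ _; rewrite /euclid /=; apply: sqrtE => //.
    by rewrite real_normK ?num_real//; ring.
  - rewrite c0 metric_sym c'l//; split; first by congr pair; field.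
      by congr pair; field.
    move=> u v _ _; rewrite /euclid /=; apply: sqrtE => //.
    transitivity (((u - v) / t) ^+ 2 * ((D / 2) ^+ 2 + h ^+ 2)); first by field.
    by rewrite h2 real_normK ?num_real//; field.
have := @cat0_comparison R X p k p' k' tri tri' len ord0 (@Ordinal 3 2 isT) s (t - s).
rewrite oS0 oS2 /p /k /k' /tnth /= cl// c0 metric_sym c'l//.
have -> : t - (t - s) = s by ring.
move=> H; apply: le_trans (H _ _) _; [by apply/andP; split; lra..|].
rewrite /euclid /= (sqrtE (D * (s / t))); last by field.
  by rewrite ler_piMr// ler_pdivrMr// mul1r.
by rewrite mulr_ge0// divr_ge0.
Qed.

Lemma cone_nbhd_decr (x0 : X) alpha (r r' e : R) : 0 < r -> r <= r' ->
  cone_nbhd x0 (inr alpha) r' e `<=` cone_nbhd x0 (inr alpha) r e.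
Proof.
move=> r0 rr' w [wfar [c [c' [ca cw ce]]]]; split.
  by move=> [x xr xw]; apply: wfar; exists x => //; exact: le_trans rr'.
exists c, c'; split => //; apply: le_lt_trans ce.
have [xi [-> xi0 _]] := ca.
have r'0 : 0 <= r' by rewrite (le_trans (ltW r0)).
apply: fan; first by rewrite (ltW r0) rr'.
- case: w cw {wfar} => [x [-> _ _]//|beta [zeta [-> -> _]]//].
- by move=> u v /andP[u0 _] /andP[v0 _]; exact: ray_isometric.
- case: w cw wfar => [x [c'0 c'd c'i] wfar|beta [zeta [-> _ _]] _]; last first.
    by move=> u v /andP[u0 _] /andP[v0 _]; exact: ray_isometric.
  have r'd : r' <= mdist x0 x.
    by rewrite leNgt; apply/negP => xr'; apply: wfar; exists x => //; exact: ltW.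
  by move=> u v /andP[u0 ur] /andP[v0 vr]; apply: c'i; rewrite ?u0 ?v0 (le_trans _ r'd).
Qed.

Let cone_openT (x0 : X) : cone_open (x0 := x0) setT.
Proof.
by split=> [|alpha _ e e0]; [rewrite preimage_setT; exact: openT|exists 1].
Qed.

Let cone_openI (x0 : X) : setI_closed (cone_open (x0 := x0)).
Proof.
move=> A B [oA hA] [oB hB]; split; first by rewrite preimage_setI; exact: openI.
move=> alpha [Aa Ba] e e0.
have [r r0 rA] := hA _ Aa _ e0; have [s s0 sB] := hB _ Ba _ e0.
exists (Num.max r s); first by rewrite lt_max r0.
move=> w ww; split.
- by apply: rA; apply: cone_nbhd_decr ww => //; rewrite le_max lexx.
- by apply: sB; apply: cone_nbhd_decr ww => //; rewrite le_max lexx orbT.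
Qed.

Let cone_open_bigU (x0 : X) (I : Type) (f : I -> set (bordification x0)) :
  (forall i, cone_open (f i)) -> cone_open (\bigcup_i f i).
Proof.
move=> fo; split.
  by rewrite preimage_bigcup; apply: bigcup_open => i _; case: (fo i).
move=> alpha [i _ fia] e e0; have [_ /(_ _ fia _ e0)[r r0 rf]] := fo i.
by exists r => // w /rf fw; exists i.
Qed.

HB.instance Definition _ (x0 : X) :=
  isOpenTopological.Build (bordification x0)
    (@cone_openT x0) (@cone_openI x0) (@cone_open_bigU x0).

End ConeTopology.

(* The boundary with the subspace topology of the bordification. *)
Definition boundary_at {R : realType} {X : cat0Type R} (x0 : X) : Type :=
  initial_topology (inr : boundary X -> bordification x0).
HB.instance Definition _ (R : realType) (X : cat0Type R) (x0 : X) :=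
  Topological.on (boundary_at x0).

Record geometric_action {R : realType} (G : groupType) (X : metricType R) := {
  gact :> G -> X -> X ;
  gact1 : forall x, gact 1%g x = x ;
  gactM : forall g h x, gact (g * h)%g x = gact g (gact h x) ;
  gact_isometry : forall g x y, mdist (gact g x) (gact g y) = mdist x y ;
  gact_proper : forall x, exists2 r : R, 0 < r &
    finite_set [set g | (gact g @` cball x r) `&` cball x r !=set0] ;
  gact_cocompact : exists2 K : set X, compact K &
    \bigcup_(g in [set: G]) (gact g @` K) = [set: X] }.

Section BoundaryAction.
Context {R : realType} {G : groupType} {X : metricType R}.
Variable act : geometric_action G X.

Let ray_act_isometric (g : G) (xi : ray X) (s t : R) : 0 <= s -> 0 <= t ->
  mdist (act g (xi s)) (act g (xi t)) = `|s - t|.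
Proof. by move=> s0 t0; rewrite gact_isometry ray_isometric. Qed.

Definition ray_act (g : G) (xi : ray X) : ray X :=
  @Ray R X (fun t => act g (xi t)) (@ray_act_isometric g xi).

Definition boundary_act (g : G) (alpha : boundary X) : boundary X :=
  endpoint (ray_act g (repr alpha)).

Lemma boundary_actE g xi : boundary_act g (endpoint xi) = endpoint (ray_act g xi).
Proof.
apply/endpointP.
have /endpointP[C hC] : endpoint (repr (endpoint xi)) = endpoint xi.
  exact: reprK.
by exists C => s /hC[t t0 tC]; exists t => //=; rewrite gact_isometry.
Qed.

End BoundaryAction.

Definition is_homeomorphism {S T : topologicalType} (f : S -> T) : Prop :=
  continuous f /\
  exists g : T -> S, [/\ cancel f g, cancel g f & continuous g].

(* The map being extended is g x0 |-> g y0. If the stabilizer of x0 does not fix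
   y0 it is only a coarse map, so it is represented by the sequences g i in G
   and not by a function on the orbit of x0. *)
Definition is_continuous_extension {R : realType} {G : groupType}
    {X Y : cat0Type R} (actX : geometric_action G X) (actY : geometric_action G Y)
    (x0 : X) (y0 : Y) (phi : boundary_at x0 -> boundary_at y0) : Prop :=
  continuous phi /\
  forall (g : nat -> G) (alpha : boundary_at x0),
    (inl (actX (g i) x0) : bordification x0) @[i --> \oo]
      --> (inr alpha : bordification x0) ->
    (inl (actY (g i) y0) : bordification y0) @[i --> \oo]
      --> (inr (phi alpha) : bordification y0).

Definition is_equivariant {R : realType} {G : groupType}
    {X Y : metricType R} (actX : geometric_action G X) (actY : geometric_action G Y)
    (phi : boundary X -> boundary Y) : Prop :=
  forall g alpha, phi (boundary_act actX g alpha) = boundary_act actY g (phi alpha).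

(* Main.v *)
Require Import Defs.
From mathcomp Require Import all_boot all_order all_algebra.
From mathcomp Require Import ring lra.
From mathcomp Require Import all_classical all_reals all_analysis.

Set Implicit Arguments.
Unset Strict Implicit.
Unset Printing Implicit Defensive.

Import Order.TTheory GRing.Theory Num.Theory.
Import numFieldNormedType.Exports.

Local Open Scope classical_set_scope.
Local Open Scope ring_scope.

(** The theorem rests on one estimate: two geodesics issuing from the same point
    spread at least linearly, that is t d(c s, c' s) <= s d(c t, c' t) for
    s <= t ([contraction]).  Read backwards, a bound K on the distance at a
    large radius t forces a distance at most (s/t) K at a fixed radius s.
    Hence any bound on the spread of a family of geodesics that is uniform in
    the radius already forces them to agree in the limit.  This makes geodesics
    unique, and lets convergence to a boundary point be expressed by the coarse
    condition [converges], which is visibly stable under bounded perturbation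
    of the sequence ([converges_close]), change of basepoint
    ([converges_basepoint]) and isometries ([converges_act]).

    The other source is properness: along an ultrafilter on the indices every
    sequence of geodesics from x to points escaping to infinity converges
    pointwise, and the limit is a ray ([limit_ray]).  This gives the ray from
    an arbitrary basepoint to a given boundary point ([ray_from]), the limits
    of Cauchy sequences ([converges_cauchy]), and converging subsequences
    ([escapes_converging_subseq]).

    Suppose first that the two orbit maps have the same Cauchy sequences.  By
    cocompactness every boundary point alpha of X is the
    limit of some g_i x0 ([boundary_reached]).  The sequence g_i y0 is then
    Cauchy, and its limit depends on alpha alone, because two sequences with the
    same limit can be interleaved into a single Cauchy sequence
    ([cauchy_preserving_extends]).  The resulting map phi of boundaries is
    equivariant since limits commute with G ([extends_equivariant]), and
    continuous by a diagonal argument ([extends_continuous]).  Exchanging X and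
    Y yields its inverse.

    Suppose now that the orbit map extends to a homeomorphism phi.  A Cauchy
    sequence g_i x0 converges, hence so does g_i y0.
    Conversely let g_i y0 converge to beta.  By properness of the action g_i x0
    leaves every ball ([escapes_transfer]), so each of its subsequences has a
    further subsequence converging to some alpha, and phi alpha = beta.  As phi
    is injective all these limits agree, so g_i x0 itself converges
    ([extends_reflects_convergence]). *)

(** * Comparison with Euclidean triangles *)

Section EuclideanPlane.
Context {R : realType}.
Implicit Types u v : R * R.

(** Dividing by the length 0 gives 0, so that the segment between equal points
    is constant and the degenerate case is covered by the same formula. *)
Definition euclid_segment u v (s : R) : R * R :=
  (u.1 + s / euclid u v * (v.1 - u.1), u.2 + s / euclid u v * (v.2 - u.2)).

Lemma euclid_eq0 u v : euclid u v = 0 -> u = v.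
Proof.
move=> /eqP; rewrite sqrtr_eq0 => uv.
have h1 := sqr_ge0 (u.1 - v.1); have h2 := sqr_ge0 (u.2 - v.2).
have /eqP : (u.1 - v.1) ^+ 2 = 0 by lra.
have /eqP : (u.2 - v.2) ^+ 2 = 0 by lra.
rewrite !sqrf_eq0 !subr_eq0 => /eqP e2 /eqP e1.
by case: u v e1 e2 {uv h1 h2} => [? ?] [? ?] /= -> ->.
Qed.

Lemma euclidZ (a : R) u v : 0 <= a ->
  euclid (a * u.1, a * u.2) (a * v.1, a * v.2) = a * euclid u v.
Proof.
move=> a0; rewrite /euclid /= -!mulrBr !exprMn -mulrDr sqrtrM ?sqr_ge0//.
by rewrite sqrtr_sqr ger0_norm.
Qed.

Lemma euclid_segmentP u v : is_geodesic euclid u v (euclid_segment u v).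
Proof.
set L := euclid u v; have L0 : 0 <= L by exact: sqrtr_ge0.
rewrite /is_geodesic -/L /euclid_segment -/L; split.
- by rewrite !mul0r !addr0; case: (u).
- have [L00|Ln] := eqVneq L 0.
    by rewrite L00 !mul0r !addr0 (euclid_eq0 L00); case: (v).
  by rewrite divff// !mul1r ![_ + (_ - _)]addrC !subrK; case: (v).
- move=> s t /andP[s0 sL] /andP[t0 tL].
  have [L00|Ln] := eqVneq L 0.
    have -> : s = 0 by lra.
    have -> : t = 0 by lra.
    by rewrite /euclid !subrr expr0n addr0 sqrtr0 normr0.
  rewrite /euclid /=.
  transitivity (Num.sqrt (((s - t) / L) ^+ 2 * L ^+ 2)).
    congr Num.sqrt; rewrite [L ^+ 2]sqr_sqrtr ?addr_ge0 ?sqr_ge0//; ring.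
  by rewrite -exprMn divfK// sqrtr_sqr.
Qed.

End EuclideanPlane.

Section Comparison.
Context {R : realType} {X : cat0Type R}.
Implicit Types (x y z : X) (c : R -> X).

(** Once the vertices of a comparison triangle are known, its sides can be taken
    to be straight segments; only the two sides meeting at x are compared. *)
Lemma comparison_at_vertex x y z c c' (p q r : R * R) (s t : R) :
  is_geodesic mdist x y c -> is_geodesic mdist z x c' ->
  euclid p q = mdist x y -> euclid q r = mdist y z -> euclid r p = mdist z x ->
  0 <= s <= mdist x y -> 0 <= t <= mdist z x ->
  mdist (c s) (c' t) <= euclid (euclid_segment p q s) (euclid_segment r p t).
Proof.
move=> cg c'g pq qr rp sI tI; have [b bg] := cat0_geodesic y z.
pose P i : X := tnth [tuple x; y; z] i.
pose k i : R -> X := tnth [tuple c; b; c'] i.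
pose P' i : R * R := tnth [tuple p; q; r] i.
pose k' i : R -> R * R := euclid_segment (P' i) (P' (ordS i)).
have oS0 : ordS (ord0 : 'I_3) = @Ordinal 3 1 isT by exact: val_inj.
have oS1 : ordS (@Ordinal 3 1 isT) = @Ordinal 3 2 isT by exact: val_inj.
have oS2 : ordS (@Ordinal 3 2 isT) = (ord0 : 'I_3) by exact: val_inj.
have I3 (Q : 'I_3 -> Prop) : Q ord0 -> Q (@Ordinal 3 1 isT) ->
    Q (@Ordinal 3 2 isT) -> forall i, Q i.
  move=> Q0 Q1 Q2 [[|[|[|//]]] i3].
  - by rewrite (_ : Ordinal i3 = ord0)//; exact: val_inj.
  - by rewrite (_ : Ordinal i3 = @Ordinal 3 1 isT)//; exact: val_inj.
  - by rewrite (_ : Ordinal i3 = @Ordinal 3 2 isT)//; exact: val_inj.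
have tri : is_geodesic_triangle mdist P k.
  by apply: I3; rewrite ?oS0 ?oS1 ?oS2.
have len i : euclid (P' i) (P' (ordS i)) = mdist (P i) (P (ordS i)).
  by move: i; apply: I3; rewrite ?oS0 ?oS1 ?oS2.
have tri' : is_geodesic_triangle euclid P' k' by move=> i; exact: euclid_segmentP.
have := @cat0_comparison R X P k P' k' tri tri' len ord0 (@Ordinal 3 2 isT) s t.
by rewrite /k' !oS0 !oS2; apply.
Qed.

(** In the comparison triangle of an isosceles triangle the points at distance s
    from the apex are the images of the base vertices under the homothety of
    ratio s/t centred at the apex. *)
Lemma isosceles_contraction x y z c c' (s t : R) :
  is_geodesic mdist x y c -> is_geodesic mdist x z c' ->
  mdist x y = t -> mdist x z = t -> 0 <= s <= t ->
  t * mdist (c s) (c' s) <= s * mdist y z.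
Proof.
move=> cg c'g xy xz /andP[s0 st]; have t0 := le_trans s0 st.
have [t00|tn0] := eqVneq t 0.
  by rewrite t00 mul0r mulr_ge0 ?mdist_ge0.
have tp : 0 < t by rewrite lt_neqAle eq_sym tn0.
set D := mdist y z; have D0 : 0 <= D by exact: mdist_ge0.
have Dt : D <= t + t.
  by rewrite (le_trans (metric_triangle y x z))// (metric_sym y) xy xz.
(* The apex is at the origin and the base is vertical, at distance h. *)
pose h := Num.sqrt (t ^+ 2 - (D / 2) ^+ 2).
have h2 : h ^+ 2 = t ^+ 2 - (D / 2) ^+ 2.
  by rewrite sqr_sqrtr// subr_ge0 lerXn2r ?nnegrE ?divr_ge0//; lra.
have sqrtE (a q : R) : 0 <= a -> q = a ^+ 2 -> Num.sqrt q = a.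
  by move=> a0 ->; rewrite sqrtr_sqr ger0_norm.
pose p : R * R := (0, 0); pose q : R * R := (h, D / 2).
pose r : R * R := (h, - (D / 2)).
have pq : euclid p q = t by apply: sqrtE => //=; rewrite !sub0r !sqrrN h2; ring.
have qr : euclid q r = D by apply: sqrtE => //=; field.
have rp : euclid r p = t by apply: sqrtE => //=; rewrite !subr0 sqrrN h2; ring.
have c'rev : is_geodesic mdist z x (fun u => c' (t - u)).
  case: c'g => c'0 c'z c'I; rewrite /is_geodesic (metric_sym z) xz subr0 subrr.
  rewrite -{1}xz; split=> // u v /andP[u0 ut] /andP[v0 vt].
  rewrite c'I ?xz; [|by apply/andP; split; lra..].
  by rewrite -normrN; congr (`| _ |); ring.
have := @comparison_at_vertex x y z _ _ p q r s (t - s) cg c'rev.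
rewrite pq qr rp (metric_sym z) xy xz subKr => /(_ erefl erefl erefl).
rewrite s0 st subr_ge0 st gerBl s0 => /(_ isT isT) => H.
have -> : s * D = t * euclid (euclid_segment p q s) (euclid_segment r p (t - s)).
  rewrite -qr -!euclidZ//=; congr euclid;
    by rewrite /euclid_segment ?pq ?rp /=; congr pair; field.
by rewrite ler_pM2l.
Qed.

End Comparison.

(** * Geodesics with a common endpoint *)

Section Geodesics.
Context {R : realType} {X : cat0Type R}.
Implicit Types (x y z : X) (c : R -> X) (xi zeta : ray X).

Lemma mdist_dist x y z : `|mdist x y - mdist x z| <= mdist y z.
Proof.
have h1 := metric_triangle x y z; have h2 := metric_triangle x z y.
rewrite (metric_sym z y) in h2.
by rewrite ler_norml; apply/andP; split; lra.
Qed.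

Lemma geodesic_dist0 x y c t : is_geodesic mdist x y c -> 0 <= t <= mdist x y ->
  mdist x (c t) = t.
Proof.
move=> [c0 _ cI] tI; have /andP[t0 _] := tI.
by rewrite -{1}c0 cI ?lexx ?mdist_ge0// sub0r normrN ger0_norm.
Qed.

Lemma geodesic_init x y c t : is_geodesic mdist x y c -> 0 <= t <= mdist x y ->
  is_geodesic mdist x (c t) c.
Proof.
move=> cg tI; have /andP[t0 tL] := tI.
rewrite /is_geodesic (geodesic_dist0 cg tI).
case: cg => c0 _ cI; split=> // u v /andP[u0 ut] /andP[v0 vt].
by rewrite cI ?u0 ?v0 ?(le_trans _ tL).
Qed.

Lemma geodesic_rev x y c : is_geodesic mdist x y c ->
  is_geodesic mdist y x (fun t => c (mdist x y - t)).
Proof.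
move=> [c0 cy cI]; rewrite /is_geodesic (metric_sym y x) subr0 subrr.
split=> // u v /andP[u0 ut] /andP[v0 vt].
rewrite cI; [|by apply/andP; split; lra..].
by rewrite -normrN; congr (`| _ |); ring.
Qed.

Lemma ray_dist0 xi t : 0 <= t -> mdist (xi 0) (xi t) = t.
Proof. by move=> t0; rewrite ray_isometric// sub0r normrN ger0_norm. Qed.

Lemma ray_geodesic xi t : 0 <= t -> is_geodesic mdist (xi 0) (xi t) xi.
Proof.
move=> t0; rewrite /is_geodesic ray_dist0//.
by split=> // u v /andP[u0 _] /andP[v0 _]; exact: ray_isometric.
Qed.

(** Cutting both geodesics at radius t makes the triangle isosceles. *)
Lemma contraction x y z c c' (s t : R) :
  is_geodesic mdist x y c -> is_geodesic mdist x z c' ->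
  0 <= s <= t -> t <= mdist x y -> t <= mdist x z ->
  t * mdist (c s) (c' s) <= s * mdist (c t) (c' t).
Proof.
move=> cg c'g sI ty tz; have /andP[s0 st] := sI; have t0 := le_trans s0 st.
by apply: (isosceles_contraction (x := x)) => //; rewrite ?(geodesic_dist0 cg)
  ?(geodesic_dist0 c'g) ?t0//; apply: geodesic_init (_ : _ <= _ <= _);
  [exact: cg| rewrite t0| exact: c'g|rewrite t0].
Qed.

Lemma geodesic_unique x y c c' t :
  is_geodesic mdist x y c -> is_geodesic mdist x y c' -> 0 <= t <= mdist x y ->
  c t = c' t.
Proof.
move=> cg c'g tI; have /andP[t0 tL] := tI.
have [t00|tn0] := eqVneq t 0.
  by case: cg c'g => [c0 _ _] [c'0 _ _]; rewrite t00 c0 c'0.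
have := contraction cg c'g tI (lexx _) (lexx _).
have [[_ -> _] [_ -> _]] := (cg, c'g).
rewrite mdistxx mulr0 => H; apply: mdist_positivity; apply/eqP.
rewrite eq_le mdist_ge0 andbT -(@pmulr_rle0 _ (mdist x y))//.
by rewrite (lt_le_trans _ tL)// lt_neqAle eq_sym tn0.
Qed.

(** The longer side is cut at the length a of the shorter one: this moves its
    end by the difference of the lengths, at most d(y, z), so the ends at
    radius a are at distance at most 2 d(y, z). *)
Lemma geodesic_lip x y z c c' r :
  is_geodesic mdist x y c -> is_geodesic mdist x z c' ->
  0 <= r -> r <= mdist x y -> r <= mdist x z ->
  mdist (c r) (c' r) <= 2 * mdist y z.
Proof.
wlog le_yz : y z c c' / mdist x y <= mdist x z.
  move=> H cg c'g r0 ry rz; have [yz|zy] := leP (mdist x y) (mdist x z).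
    exact: (H _ _ _ _ yz).
  by rewrite metric_sym (metric_sym y); apply: (H _ _ _ _ (ltW zy)).
move=> cg c'g r0 ry rz; set a := mdist x y.
have [r00|rn0] := eqVneq r 0.
  have [[c0 _ _] [c'0 _ _]] := (cg, c'g).
  by rewrite r00 c0 c'0 mdistxx mulr_ge0 ?mdist_ge0.
have rp : 0 < r by rewrite lt_neqAle eq_sym rn0.
have ap : 0 < a by exact: lt_le_trans ry.
have aa : 0 <= a <= a by rewrite lexx ltW.
have ra : 0 <= r <= a by rewrite r0.
have aI : 0 <= a <= mdist x z by rewrite le_yz ltW.
have H := contraction cg c'g ra (lexx _) le_yz.
have ya : mdist (c a) (c' a) <= 2 * mdist y z.
  have [_ cy _] := cg; have [_ c'z c'I] := c'g; rewrite cy.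
  apply: le_trans (metric_triangle _ z _) _.
  rewrite -{2}c'z c'I// ?lexx ?mdist_ge0// /a.
  have := mdist_dist x y z; rewrite distrC; lra.
rewrite -(ler_pM2l ap); apply: le_trans H _.
apply: le_trans (ler_wpM2l r0 ya) _.
by rewrite ler_wpM2r// mulr_ge0 ?mdist_ge0.
Qed.

(** Seen from the common end z, [geodesic_lip] compares the points at equal
    distance from z.  Passing to equal distance from the origins shifts the
    parameter by the difference of the lengths, which costs d(x, y) once
    more. *)
Lemma fellow_travel x y z c c' r :
  is_geodesic mdist x z c -> is_geodesic mdist y z c' ->
  0 <= r -> r <= mdist x z -> r <= mdist y z ->
  mdist (c r) (c' r) <= 3 * mdist x y.
Proof.
wlog le_xy : x y c c' / mdist x z <= mdist y z.
  move=> H cg c'g r0 ry rz; have [yz|zy] := leP (mdist x z) (mdist y z).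
    exact: (H _ _ _ _ yz).
  by rewrite metric_sym (metric_sym x); apply: (H _ _ _ _ (ltW zy)).
move=> cg c'g r0 rx ry.
set a := mdist x z in rx le_xy *; set b := mdist y z in ry le_xy *.
have := mdist_dist z x y; rewrite !(metric_sym z) -/a -/b ler_norml => /andP[ab _].
have := geodesic_lip (r := a - r) (geodesic_rev cg) (geodesic_rev c'g).
rewrite !(metric_sym z) -/a -/b subKr !subr_ge0 gerBl => /(_ rx r0).
have -> : b - (a - r) = b - a + r by ring.
have arb : a - r <= b by rewrite (le_trans _ le_xy)// gerBl.
move=> /(_ arb) H.
apply: le_trans (metric_triangle _ (c' (b - a + r)) _) _.
have [_ _ c'I] := c'g.
rewrite c'I ?r0//; last by rewrite -/b; apply/andP; split; lra.
rewrite addrK ger0_norm ?subr_ge0//.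
lra.
Qed.

End Geodesics.

(** * Limits along ultrafilters and geodesic rays *)

Lemma fmap_ultra {S T : Type} (f : S -> T) (U : set_system S) :
  UltraFilter U -> UltraFilter (f @ U).
Proof.
move=> UU; split; first exact: fmap_proper_filter.
move=> G GF fUG; apply/seteqP; split=> // A GA.
have [//|UnA] := in_ultra_setVsetC (f @^-1` A) UU.
have /fUG GnA : (f @ U) (~` A) by exact: UnA.
by have [x []] := filter_ex (filterI GA GnA).
Qed.

Lemma ultra_compact_cvg {S : Type} {T : topologicalType} (U : set_system S)
    (K : set T) (f : S -> T) : UltraFilter U -> compact K ->
  (\forall i \near U, K (f i)) -> exists p : T, f @ U --> p.
Proof.
move=> UU; rewrite compact_ultra => cK Kf.
by have [p [_ fp]] := cK _ (fmap_ultra f UU) Kf; exists p.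
Qed.

Section LimitRays.
Context {R : realType} {X : cat0Type R}.
Implicit Types (x y z : X) (c : R -> X) (xi zeta : ray X).

Definition seg x y : R -> X := projT1 (cid (cat0_geodesic x y)).

Lemma segP x y : is_geodesic mdist x y (seg x y).
Proof. by rewrite /seg; case: cid. Qed.

Definition escapes x (y : nat -> X) : Prop :=
  forall r : R, \forall i \near \oo, r < mdist x (y i).

(** The ray is the pointwise limit of the segments from x to the y n along an
    ultrafilter.  Of this limit only the following is kept: each point of the
    ray is approached by segments of arbitrarily large index.  A single radius
    is enough, since by [contraction] closeness at one radius controls all
    smaller ones. *)
Lemma limit_ray x (y : nat -> X) : escapes x y ->
  exists2 xi : ray X, xi 0 = x & forall r e N, 0 <= r -> 0 < e ->
    exists2 n, (N <= n)%N & mdist (seg x (y n) r) (xi r) < e.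
Proof.
move=> yoo.
have [U [UU sU]] := @ultraFilterLemma nat \oo _.
have nearU (P : nat -> Prop) : (\forall i \near \oo, P i) -> \forall i \near U, P i.
  by move=> /sU.
have farU t : \forall i \near U, t <= mdist x (y i).
  by apply: nearU; apply: filterS (yoo t) => i /ltW.
have [f fP] : {f : R -> X & forall t, 0 <= t -> seg x (y i) t @[i --> U] --> f t}.
  apply: (@choice _ _ (fun t p => 0 <= t -> seg x (y i) t @[i --> U] --> p)) => t.
  have [t0|_] := boolP (0 <= t); last by exists x.
  have near_ball : \forall i \near U, cball x t (seg x (y i) t).
    apply: filterS (farU t) => i ti.
    by rewrite /cball /= (geodesic_dist0 (segP _ _)) ?t0.
  by have [p fp] := ultra_compact_cvg UU (@cat0_proper _ _ x t) near_ball; exists p.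
have fnear t e : 0 <= t -> 0 < e ->
    \forall i \near U, mdist (f t) (seg x (y i) t) < e.
  by move=> /fP /metricType_numDomainType.cvgrPdist_lt; apply.
have f_iso s t : 0 <= s -> 0 <= t -> mdist (f s) (f t) = `|s - t|.
  move=> s0 t0.
  suff : forall e, 0 < e -> `|mdist (f s) (f t) - `|s - t| | <= e.
    move=> H; apply/eqP; rewrite -subr_eq0 -normr_le0.
    by apply/ler_addgt0Pl => e e0; rewrite addr0; exact: H.
  move=> e e0; have e20 : 0 < e / 2 by rewrite divr_gt0.
  have [i [[si ti] [sn tn]]] := filter_ex (filterI (filterI (farU s) (farU t))
    (filterI (fnear _ _ s0 e20) (fnear _ _ t0 e20))).
  have [_ _ cI] := segP x (y i).
  have := cI s t; rewrite s0 si t0 ti => /(_ isT isT) <-.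
  have h1 := mdist_dist (f s) (f t) (seg x (y i) t).
  have h2 := mdist_dist (seg x (y i) t) (f s) (seg x (y i) s).
  rewrite !(metric_sym (seg x (y i) t)) in h2.
  apply: le_trans (ler_distD (mdist (f s) (seg x (y i) t)) _ _) _.
  lra.
exists (Ray f_iso) => /=.
  apply: mdist_positivity; apply/eqP; rewrite eq_le mdist_ge0 andbT.
  apply/ler_addgt0Pl => e e0; rewrite addr0.
  have [i fi] := filter_ex (fnear 0 e (lexx _) e0).
  by have [<- _ _] := segP x (y i); exact: ltW.
move=> r e N r0 e0.
have [i [Ni fi]] := filter_ex (filterI (nearU _ (nbhs_infty_ge N))
  (fnear r e r0 e0)).
by exists i => //; rewrite metric_sym.
Qed.

(** If d(xi t, zeta s) <= C, then t and s are the distances to the two origins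
    and differ by at most C + d(xi 0, zeta 0), so that zeta s can be replaced
    by zeta t. *)
Lemma asymptotic_sync xi zeta : asymptotic xi zeta <->
  exists C, forall t, 0 <= t -> mdist (xi t) (zeta t) <= C.
Proof.
split=> [[C xC]|[C xC]]; last by exists C => t t0; exists t => //; exact: xC.
exists (C + (mdist (xi 0) (zeta 0) + C)) => t t0.
have [s s0 sC] := xC _ t0.
have h0 := mdist_dist (zeta 0) (xi t) (zeta s).
have h1 := mdist_dist (xi t) (xi 0) (zeta 0).
rewrite !(metric_sym _ (xi 0)) !(metric_sym _ (zeta 0)) !ray_dist0// in h0 h1.
apply: le_trans (metric_triangle _ (zeta s) _) _; rewrite lerD//.
rewrite ray_isometric//.
apply: le_trans (ler_distD (mdist (zeta 0) (xi t)) _ _) _.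
rewrite (metric_sym (xi 0)) (distrC s) (distrC _ t); lra.
Qed.

Lemma linear_bound_eq0 (a b C : R) : 0 <= a ->
  (forall t, b <= t -> t * a <= C) -> a = 0.
Proof.
move=> a0 H; apply/eqP; rewrite eq_le a0 andbT leNgt; apply/negP => ap.
pose t := Num.max b ((C + 1) / a).
have := H t; rewrite le_max lexx => /(_ isT).
have : (C + 1) / a <= t by rewrite le_max lexx orbT.
rewrite ler_pdivrMr//; lra.
Qed.

(** If C bounds the distance of the rays, [contraction] bounds their distance at t
    by (t/s) C for every s >= t. *)
Lemma asymptotic_eq xi zeta t : xi 0 = zeta 0 -> asymptotic xi zeta ->
  0 <= t -> xi t = zeta t.
Proof.
move=> x0 /asymptotic_sync[C xC] t0; apply: mdist_positivity.
apply: (@linear_bound_eq0 _ t (t * C)); first exact: mdist_ge0.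
move=> s ts; have s0 := le_trans t0 ts.
have zg : is_geodesic mdist (xi 0) (zeta s) zeta.
  by rewrite x0; exact: ray_geodesic.
have xg := ray_geodesic xi s0.
apply: le_trans (contraction xg zg _ _ _) _.
- by rewrite t0 ts.
- by rewrite ray_dist0.
- by rewrite x0 ray_dist0.
- by rewrite ler_wpM2l// xC.
Qed.

(** The segments from x to the points zeta n stay within 3 d(x, zeta 0) of zeta
    by [fellow_travel], hence so does a limit ray. *)
Lemma ray_from x zeta :
  exists2 xi : ray X, xi 0 = x & asymptotic xi zeta.
Proof.
have zoo : escapes x (fun n => zeta n%:R).
  move=> r; near=> n.
  have h := mdist_dist (zeta n%:R) x (zeta 0).
  rewrite !(metric_sym (zeta n%:R)) ray_dist0// ler_norml in h.
  have : r + mdist x (zeta 0) < n%:R by near: n; exact: nbhs_infty_gtr.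
  by case/andP: h; lra.
have [xi xi0 xiP] := limit_ray zoo; exists xi => //.
apply/asymptotic_sync; exists (3 * mdist x (zeta 0) + 1) => t t0.
have [N _ NP] : \forall i \near \oo, t < mdist x (zeta i%:R) /\ t <= i%:R.
  by near do split; [exact: zoo|exact: nbhs_infty_ger].
have [n /NP[tx tn] /ltW xin] := xiP t 1 N t0 ltr01.
apply: le_trans (metric_triangle _ (seg x (zeta n%:R) t) _) _.
rewrite addrC lerD//; last by rewrite metric_sym.
apply: (fellow_travel (z := zeta n%:R)) => //; first exact: segP.
- exact: ray_geodesic.
- exact: ltW.
- by rewrite ray_dist0.
Unshelve. all: by end_near. Qed.

End LimitRays.

(** * Sequences of indices *)

Section Sequences.

Lemma not_near_subseq (P : nat -> Prop) : ~ (\forall i \near \oo, P i) ->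
  exists2 k : nat -> nat, (forall n, (n <= k n)%N) & forall n, ~ P (k n).
Proof.
move=> nP.
have [k kP] : {k : nat -> nat & forall n, (n <= k n)%N /\ ~ P (k n)}.
  apply: (@choice _ _ (fun n m => (n <= m)%N /\ ~ P m)) => n.
  apply: contrapT => H; apply: nP; exists n => // m /= nm.
  by apply: contrapT => nPm; apply: H; exists m.
by exists k => n; have [] := kP n.
Qed.

Lemma cvg_ge_infty (k : nat -> nat) : (forall n, (n <= k n)%N) -> k @ \oo --> \oo.
Proof.
move=> kn A [N _ NA]; exists N => // n /= Nn; apply: NA => /=.
exact: leq_trans (kn n).
Qed.

Definition interleave {T : Type} (u v : nat -> T) (i : nat) : T :=
  if odd i then v i./2 else u i./2.

Lemma interleave_comp {S T : Type} (f : S -> T) (u v : nat -> S) :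
  (fun i => f (interleave u v i)) =
  interleave (fun i => f (u i)) (fun i => f (v i)).
Proof. by apply/funext => i; rewrite /interleave; case: odd. Qed.

End Sequences.

(** * The cone topology and convergence to boundary points *)

Section Convergence.
Context {R : realType} {X : cat0Type R}.
Implicit Types (x y z : X) (c : R -> X) (xi zeta : ray X) (u v : nat -> X).
Implicit Types (alpha beta : boundary X) (w : X + boundary X).

Lemma ray_to_subproof x alpha :
  exists xi : ray X, xi 0 = x /\ endpoint xi = alpha.
Proof.
have [xi xi0 /endpointP xia] := ray_from x (repr alpha).
by exists xi; split=> //; rewrite xia; exact: reprK.
Qed.

Definition ray_to x alpha : ray X := projT1 (cid (ray_to_subproof x alpha)).

Lemma ray_to0 x alpha : ray_to x alpha 0 = x.
Proof. by rewrite /ray_to; case: cid => xi []. Qed.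

Lemma endpoint_ray_to x alpha : endpoint (ray_to x alpha) = alpha.
Proof. by rewrite /ray_to; case: cid => xi []. Qed.

Lemma ray_toE x alpha xi t : xi 0 = x -> endpoint xi = alpha -> 0 <= t ->
  ray_to x alpha t = xi t.
Proof.
move=> xi0 xia t0; apply: asymptotic_eq => //; first by rewrite ray_to0 xi0.
by apply/endpointP; rewrite endpoint_ray_to xia.
Qed.

Lemma boundary_eq x alpha beta C :
  (forall t, 0 <= t -> mdist (ray_to x alpha t) (ray_to x beta t) <= C) ->
  alpha = beta.
Proof.
move=> H; rewrite -(endpoint_ray_to x alpha) -(endpoint_ray_to x beta).
by apply/endpointP/asymptotic_sync; exists C.
Qed.

Definition geod_to x w : R -> X :=
  match w with inl y => seg x y | inr alpha => ray_to x alpha end.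

(** For a point outside the ball of radius r, the geodesic from x is defined up
    to radius r; rays are defined at all radii. *)
Definition far x w (r : R) : Prop :=
  match w with inl y => r < mdist x y | inr _ => True end.

Lemma far_le x w r t : r <= t -> far x w t -> far x w r.
Proof. by case: w => //= y; exact: le_lt_trans. Qed.

Lemma geod_to_geodesic x w t : 0 <= t -> far x w t ->
  is_geodesic mdist x (geod_to x w t) (geod_to x w).
Proof.
move=> t0; case: w => [y|alpha] /= wf.
  by apply: geodesic_init (segP _ _) _; rewrite t0 ltW.
by rewrite -{1}(ray_to0 x alpha); exact: ray_geodesic.
Qed.

Lemma geod_to_dist x w t : 0 <= t -> far x w t -> mdist x (geod_to x w t) = t.
Proof.
move=> t0; case: w => [y|alpha] /= wf.
  by apply: geodesic_dist0 (segP _ _) _; rewrite t0 ltW.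
by rewrite -{1}(ray_to0 x alpha) ray_dist0.
Qed.

Lemma geod_to_contraction x w w' s t : 0 <= s <= t -> far x w t -> far x w' t ->
  t * mdist (geod_to x w s) (geod_to x w' s) <=
  s * mdist (geod_to x w t) (geod_to x w' t).
Proof.
move=> st wt w't; have t0 : 0 <= t by case/andP: st; exact: le_trans.
apply: contraction (geod_to_geodesic t0 wt) (geod_to_geodesic t0 w't) st _ _;
  by rewrite geod_to_dist.
Qed.

Lemma geod_to_le x w w' s t : 0 < s -> s <= t -> far x w t -> far x w' t ->
  mdist (geod_to x w s) (geod_to x w' s) <= mdist (geod_to x w t) (geod_to x w' t).
Proof.
move=> s0 st wt w't; have tp := lt_le_trans s0 st.
have stI : 0 <= s <= t by rewrite st ltW.
rewrite -(ler_pM2l tp) (le_trans (geod_to_contraction stI wt w't))//.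
by rewrite ler_wpM2r// mdist_ge0.
Qed.

(** The radius t depends only on r, K and e: this uniformity turns bounds into
    limits. *)
Lemma geod_to_shrink (r K e : R) : 0 <= r -> 0 < e ->
  exists t, [/\ 0 < t, r <= t & forall x w w', far x w t -> far x w' t ->
    mdist (geod_to x w t) (geod_to x w' t) <= K ->
    mdist (geod_to x w r) (geod_to x w' r) < e].
Proof.
move=> r0 e0; pose K' := Num.max K 0.
have K'0 : 0 <= K' by rewrite le_max lexx orbT.
have q0 : 0 <= r * K' / e by rewrite divr_ge0 ?mulr_ge0 ?(ltW e0).
(* The bound r K' / t at radius r is below e as soon as t > r K' / e. *)
exists (r + r * K' / e + 1); set t := r + _ + _.
have tp : 0 < t by rewrite /t; lra.
have rt : r <= t by rewrite /t; lra.
split=> // x w w' wt w't wK.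
have rtI : 0 <= r <= t by rewrite r0.
rewrite -(ltr_pM2l tp) (le_lt_trans (geod_to_contraction rtI wt w't))//.
apply: (@le_lt_trans _ _ (r * K')).
  by rewrite ler_wpM2l// (le_trans wK)// le_max lexx.
rewrite -ltr_pdivrMr// /t; lra.
Qed.

Lemma geodesic_toE x w c r : 0 <= r -> far x w r -> geodesic_to x w c ->
  c r = geod_to x w r.
Proof.
move=> r0; case: w => [y|alpha] /= wf.
  by move=> cg; apply: geodesic_unique cg (segP _ _) _; rewrite r0 ltW.
by move=> [xi [-> xi0 xia]]; rewrite (ray_toE xi0 xia).
Qed.

Lemma geodesic_to_geod_to x w : geodesic_to x w (geod_to x w).
Proof.
case: w => [y|alpha] /=; first exact: segP.
by exists (ray_to x alpha); rewrite ray_to0 endpoint_ray_to.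
Qed.

Lemma farP x w r : far x w r <-> ~ (inl @` cball x r) w.
Proof.
case: w => [y|alpha] /=; last by split=> // _ [].
split=> [xy [z + [zy]]|H]; first by rewrite /cball /= zy leNgt xy.
by rewrite ltNge; apply/negP => yr; apply: H; exists y.
Qed.

Lemma cone_nbhdP x w w' r e : 0 <= r -> far x w r -> cone_nbhd x w r e w' <->
  far x w' r /\ mdist (geod_to x w r) (geod_to x w' r) < e.
Proof.
move=> r0 wr; split=> [[/farP w'r [c [c' [cw c'w' ce]]]]|[w'r wwe]].
  by split=> //; rewrite -(geodesic_toE r0 wr cw) -(geodesic_toE r0 w'r c'w').
split; first exact/farP.
by exists (geod_to x w), (geod_to x w'); split=> //; exact: geodesic_to_geod_to.
Qed.

Lemma cone_nbhd_inrP x alpha w r e : 0 <= r -> cone_nbhd x (inr alpha) r e w <->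
  far x w r /\ mdist (ray_to x alpha r) (geod_to x w r) < e.
Proof. by move=> r0; exact: cone_nbhdP. Qed.

Lemma cone_nbhd_inlP x y w r e : 0 <= r -> r < mdist x y ->
  cone_nbhd x (inl y) r e w <->
  far x w r /\ mdist (seg x y r) (geod_to x w r) < e.
Proof. by move=> r0 xy; exact: cone_nbhdP. Qed.

(** In X the condition is open because the point at radius r of the segment from
    x to y depends on y in a Lipschitz way; at a boundary point beta a narrower
    neighbourhood comes from the triangle inequality and [geod_to_shrink]. *)
Lemma cone_nbhd_open x alpha r e : 0 < r ->
  open (cone_nbhd x (inr alpha) r e : set (bordification x)).
Proof.
move=> rp; have r0 := ltW rp.
split.
  rewrite openE => y /=.
  rewrite /preimage /= => /(cone_nbhd_inrP _ _ _ _ r0)[/= ry ye].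
  rewrite /interior; apply/metricType_numDomainType.nbhs_mdistP.
  pose a := mdist x y - r; pose b := (e - mdist (ray_to x alpha r) (seg x y r)) / 2.
  have ap : 0 < a by rewrite subr_gt0.
  have bp : 0 < b by rewrite divr_gt0// subr_gt0.
  have [d dp [da db]] : exists2 d, 0 < d & d <= a /\ d <= b.
    by have [ab|/ltW ba] := leP a b; [exists a|exists b].
  exists d => //= z /= yz; rewrite /a in da; rewrite /b in db.
  have h := mdist_dist x y z; rewrite ler_norml in h.
  have rz : r < mdist x z by case/andP: h => h1 h2; lra.
  apply/(cone_nbhd_inrP _ _ _ _ r0); split=> //=.
  apply: le_lt_trans (metric_triangle _ (seg x y r) _) _.
  have := geodesic_lip (segP x y) (segP x z) r0 (ltW ry) (ltW rz).
  lra.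
move=> beta /(cone_nbhd_inrP _ _ _ _ r0)[_ be] e' e'0.
have ee : 0 < e - mdist (geod_to x (inr alpha) r) (geod_to x (inr beta) r).
  by rewrite subr_gt0.
have [t [tp rt tP]] := geod_to_shrink e' r0 ee.
exists t => // w /(cone_nbhd_inrP _ _ _ _ (ltW tp))[wt /ltW we].
apply/(cone_nbhd_inrP _ _ _ _ r0); split; first exact: far_le wt.
apply: le_lt_trans (metric_triangle _ (geod_to x (inr beta) r) _) _.
have := tP x (inr beta) w I wt we; lra.
Qed.

(** The scale 1 suffices: the cone neighbourhoods are themselves open. *)
Lemma nbhs_bordificationP x alpha (B : set (bordification x)) :
  nbhs (inr alpha : bordification x) B <->
  exists2 r, 0 < r & cone_nbhd x (inr alpha) r 1 `<=` B.
Proof.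
split=> [|[r r0 rB]].
  rewrite nbhsE => -[A [[_ Ao] Aa] AB].
  by have [r r0 rA] := Ao _ Aa _ ltr01; exists r => // w /rA /AB.
rewrite nbhsE; exists (cone_nbhd x (inr alpha) r 1) => //.
split; first exact: cone_nbhd_open.
by apply: (cone_nbhd_inrP x alpha (inr alpha) 1 (ltW r0)).2; rewrite mdistxx.
Qed.

(** Asking for one bound K valid at every radius, instead of arbitrarily small
    distances, makes the condition easy to establish; [converges_lt] recovers
    the small distances. *)
Definition converges x u alpha : Prop := exists K, forall r, 0 < r ->
  \forall i \near \oo, r < mdist x (u i) /\
    mdist (seg x (u i) r) (ray_to x alpha r) <= K.

Lemma converges_escapes x u alpha : converges x u alpha -> escapes x u.
Proof.
move=> [K uK] r; have r1 : 0 < Num.max r 1 by rewrite lt_max ltr01 orbT.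
apply: filterS (uK _ r1) => i [+ _]; apply: le_lt_trans.
by rewrite le_max lexx.
Qed.

Lemma converges_lt x u alpha r e : converges x u alpha -> 0 <= r -> 0 < e ->
  \forall i \near \oo, r < mdist x (u i) /\
    mdist (seg x (u i) r) (ray_to x alpha r) < e.
Proof.
move=> [K uK] r0 e0; have [t [tp rt tP]] := geod_to_shrink K r0 e0.
apply: filterS (uK _ tp) => i [tu tK]; split; first exact: le_lt_trans tu.
exact: (tP x (inl (u i)) (inr alpha)).
Qed.

Lemma converges_cvg x u alpha : converges x u alpha <->
  ((inl (u i) : bordification x) @[i --> \oo] --> (inr alpha : bordification x)).
Proof.
split=> [ua B /nbhs_bordificationP[r r0 rB]|ua].
  apply: filterS (converges_lt ua (ltW r0) ltr01) => i [ru re].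
  by apply: rB; apply/(cone_nbhd_inrP _ _ _ _ (ltW r0)); rewrite metric_sym.
exists 1 => r r0.
have H : \forall i \near \oo, cone_nbhd x (inr alpha) r 1 (inl (u i)).
  by apply: ua; apply/nbhs_bordificationP; exists r.
apply: filterS H => i /(cone_nbhd_inrP _ _ _ _ (ltW r0))[ru /ltW].
by rewrite metric_sym.
Qed.

Lemma converges_unique x u alpha beta :
  converges x u alpha -> converges x u beta -> alpha = beta.
Proof.
move=> ua ub; apply: (@boundary_eq x _ _ (1 + 1)) => t t0.
have [i [[_ h1] [_ h2]]] := filter_ex (filterI (converges_lt ua t0 ltr01)
  (converges_lt ub t0 ltr01)).
apply: le_trans (metric_triangle _ (seg x (u i) t) _) _.
by rewrite lerD ?ltW// metric_sym.
Qed.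

(** A Cauchy sequence escapes, so its segments have a limit ray xi.  Past the
    index given by the Cauchy condition at radius r, two segments are within 2 e
    of each other there, and xi is within e of some of them. *)
Lemma converges_cauchy x u : cone_cauchy x u <-> exists alpha, converges x u alpha.
Proof.
split=> [[_ [e e0 uC]]|[alpha ua]].
  have uC' r : 0 < r -> exists i0, forall i, (i0 <= i)%N -> r < mdist x (u i) /\
      mdist (seg x (u i0) r) (seg x (u i) r) < e.
    move=> r0; have [i0 i0P] := uC r r0; exists i0 => i i0i.
    have [/farP/= fi0 _] := i0P i0 (leqnn _).
    by have /(cone_nbhd_inlP _ _ (ltW r0) fi0)[] := i0P _ i0i.
  have uoo : escapes x u.
    move=> r; have r1 : 0 < Num.max r 1 by rewrite lt_max ltr01 orbT.
    have [N NP] := uC' _ r1; exists N => // i /= /NP[+ _]; apply: le_lt_trans.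
    by rewrite le_max lexx.
  have [xi xi0 xiP] := limit_ray uoo.
  exists (endpoint xi), (e + e + e) => r r0; have [N NP] := uC' r r0.
  exists N => // i /= Ni; have [ri hi] := NP _ Ni; split=> //.
  have [n /NP[_ hn] hxi] := xiP r e N (ltW r0) e0.
  rewrite (ray_toE xi0)// ?ltW//.
  have h1 := metric_triangle (seg x (u i) r) (seg x (u N) r) (xi r).
  have h2 := metric_triangle (seg x (u N) r) (seg x (u n) r) (xi r).
  rewrite (metric_sym _ (seg x (u N) r)) in h1; lra.
split=> [[M uM]|].
  have [i] := filter_ex (converges_escapes ua M).
  by rewrite ltNge uM.
exists 1 => // r r0; have h : 0 < 1 / 2 :> R by rewrite divr_gt0.
have [N _ NP] := converges_lt ua (ltW r0) h.
exists N => i Ni; have [rN hN] := NP _ (leqnn N); have [ri hi] := NP _ Ni.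
apply/(cone_nbhd_inlP _ _ (ltW r0) rN); split=> //=.
apply: le_lt_trans (metric_triangle _ (ray_to x alpha r) _) _.
rewrite (metric_sym (ray_to _ _ _)); lra.
Qed.

Lemma converges_subseq x u alpha (k : nat -> nat) : k @ \oo --> \oo ->
  converges x u alpha -> converges x (u \o k) alpha.
Proof. by move=> koo [K uK]; exists K => r r0; exact: koo (uK r r0). Qed.

Lemma converges_interleave x u v alpha : converges x u alpha ->
  converges x v alpha -> converges x (interleave u v) alpha.
Proof.
move=> ua va; exists 1 => r r0.
have [N _ NP] := filterI (converges_lt ua (ltW r0) ltr01)
  (converges_lt va (ltW r0) ltr01).
exists N.*2 => // i /= Ni.
have [|[ur /ltW ua'] [vr /ltW va']] := NP i./2 => /=.
  by rewrite -(doubleK N) half_leq.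
by rewrite /interleave; case: odd.
Qed.

Lemma interleave_converges x u v alpha : converges x (interleave u v) alpha ->
  converges x u alpha /\ converges x v alpha.
Proof.
move=> H; split.
  have -> : u = interleave u v \o double.
    by apply/funext => i /=; rewrite /interleave odd_double doubleK.
  apply: converges_subseq H; apply: cvg_ge_infty => n.
  by rewrite -addnn leq_addr.
have -> : v = interleave u v \o (fun i => i.*2.+1).
  by apply/funext => i /=; rewrite /interleave /= odd_double /= uphalf_double.
apply: converges_subseq H; apply: cvg_ge_infty => n.
by rewrite -addnn leqW// leq_addr.
Qed.

Lemma converges_close x u v alpha D : (forall i, mdist (u i) (v i) <= D) ->
  converges x u alpha -> converges x v alpha.
Proof.
move=> uv ua; exists (2 * D + 1) => r r0.
near=> i.
have ru : r + D < mdist x (u i) by near: i; exact: converges_escapes ua _.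
have uvi := uv i; have D0 : 0 <= D := le_trans (mdist_ge0 _ _) uvi.
have h := mdist_dist x (u i) (v i); rewrite ler_norml in h.
have rv : r < mdist x (v i) by case/andP: h; lra.
split=> //; apply: le_trans (metric_triangle _ (seg x (u i) r) _) _.
apply: lerD; last first.
  by apply: ltW; near: i; apply: filterS (converges_lt ua (ltW r0) ltr01) => j [].
have := geodesic_lip (segP x (u i)) (segP x (v i)) (ltW r0) _ (ltW rv).
by rewrite metric_sym => /(_ ltac:(lra)) /le_trans; apply; rewrite ler_pM2l.
Unshelve. all: by end_near. Qed.

Lemma converges_ray x alpha : converges x (fun n => ray_to x alpha n%:R) alpha.
Proof.
exists 0 => r r0; near=> n.
have rn : r < n%:R by near: n; exact: nbhs_infty_gtr.
have n0 : 0 <= n%:R :> R by [].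
have xn : mdist x (ray_to x alpha n%:R) = n%:R.
  by rewrite -{1}(ray_to0 x alpha) ray_dist0.
rewrite xn; split=> //.
rewrite (geodesic_unique (segP x _) (c' := ray_to x alpha)) ?mdistxx//.
  by rewrite -{1}(ray_to0 x alpha); exact: ray_geodesic.
by rewrite xn !ltW.
Unshelve. all: by end_near. Qed.

(** The segments from x and x' to the same point fellow-travel, and the rays
    from x and x' to alpha are asymptotic; neither bound depends on the
    radius. *)
Lemma converges_basepoint x x' u alpha :
  converges x u alpha -> converges x' u alpha.
Proof.
move=> ua.
have : endpoint (ray_to x alpha) = endpoint (ray_to x' alpha).
  by rewrite !endpoint_ray_to.
move=> /endpointP/asymptotic_sync[C xC].
exists (3 * mdist x' x + (1 + C)) => r r0; near=> i.
have rx : r + mdist x x' < mdist x (u i) by near: i; exact: converges_escapes ua _.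
have h := mdist_dist (u i) x x'; rewrite ler_norml !(metric_sym (u i)) in h.
have D0 := mdist_ge0 x x'.
have rx' : r < mdist x' (u i) by case/andP: h; lra.
split=> //.
apply: le_trans (metric_triangle _ (seg x (u i) r) _) _; rewrite lerD//.
  by apply: (fellow_travel (z := u i)); rewrite ?ltW//; try exact: segP; lra.
apply: le_trans (metric_triangle _ (ray_to x alpha r) _) _; rewrite lerD ?xC ?ltW//.
by near: i; apply: filterS (converges_lt ua (ltW r0) ltr01) => j [].
Unshelve. all: by end_near. Qed.

(** The point p n is controlled only at its own radius n + 1; by monotonicity
    it is then controlled at every fixed radius for n large. *)
Lemma diagonal_bound x alpha (p : nat -> X + boundary X) K :
  (forall n, far x (p n) n.+1%:R /\
     mdist (geod_to x (p n) n.+1%:R) (ray_to x alpha n.+1%:R) <= K) ->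
  forall r, 0 < r -> \forall n \near \oo, far x (p n) r /\
     mdist (geod_to x (p n) r) (ray_to x alpha r) <= K.
Proof.
move=> H r r0; near=> n; have [pn pK] := H n.
have rn : r <= n.+1%:R.
  apply: (@le_trans _ _ n%:R); last by rewrite ler_nat.
  by near: n; exact: nbhs_infty_ger.
split; first exact: far_le pn.
exact: le_trans (geod_to_le (w' := inr alpha) r0 rn pn I) pK.
Unshelve. all: by end_near. Qed.

Lemma escapes_converging_subseq x u : escapes x u ->
  exists2 k : nat -> nat, (forall n, (n <= k n)%N) &
    exists alpha, converges x (u \o k) alpha.
Proof.
move=> uoo; have [xi xi0 xiP] := limit_ray uoo.
have [k kP] : {k : nat -> nat & forall n, [/\ (n <= k n)%N,
    n.+1%:R < mdist x (u (k n)) &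
    mdist (seg x (u (k n)) n.+1%:R) (xi n.+1%:R) < 1]}.
  apply: (@choice _ _ (fun n m => [/\ (n <= m)%N,
    n.+1%:R < mdist x (u m) & mdist (seg x (u m) n.+1%:R) (xi n.+1%:R) < 1])) => n.
  have [N _ NP] := uoo n.+1%:R.
  have [m + mP] := xiP n.+1%:R 1 (maxn N n) (ler0n _ _) ltr01.
  by rewrite geq_max => /andP[/NP Nm nm]; exists m.
exists k; first by move=> n; have [] := kP n.
exists (endpoint xi), 1.
apply: (@diagonal_bound x _ (fun n => inl (u (k n)))) => n /=.
by have [_ nu /ltW] := kP n; rewrite (ray_toE xi0).
Qed.

End Convergence.

(** * Geometric actions and the boundary *)

Section Actions.
Context {R : realType} {G : groupType} {X : cat0Type R}.
Variable act : geometric_action G X.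
Implicit Types (x y z : X) (g : nat -> G) (h : G) (alpha : boundary X).

Lemma compact_mdist_bounded x (K : set X) : compact K ->
  exists D, forall z, K z -> mdist x z <= D.
Proof.
move=> cK; apply: contrapT => nD.
have [k kP] : {k : nat -> X & forall n, K (k n) /\ n%:R < mdist x (k n)}.
  apply: (@choice _ _ (fun n z => K z /\ n%:R < mdist x z)) => n.
  apply: contrapT => nz; apply: nD; exists n%:R => z Kz.
  by rewrite leNgt; apply/negP => xz; apply: nz; exists z.
have [U [UU sU]] := @ultraFilterLemma nat \oo _.
have [p kp] := ultra_compact_cvg UU cK (nearW _ (fun n => (kP n).1)).
have near_p : \forall n \near U, mdist p (k n) < 1.
  by move/metricType_numDomainType.cvgrPdist_lt : kp; apply.
have [n [pn xn]] := filter_ex (filterI near_p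
  (sU _ (nbhs_infty_gtr (mdist x p + 1)))).
have [_ nk] := kP n; have := metric_triangle x p (k n); move: pn xn => /=; lra.
Qed.

Lemma orbit_cobounded x : exists D, forall z, exists h, mdist (act h x) z <= D.
Proof.
have [K cK KG] := gact_cocompact act.
have [D KD] := compact_mdist_bounded x cK; exists D => z.
have : [set: X] z by [].
rewrite -KG => -[h _ [k Kk <-]]; exists h; rewrite gact_isometry; exact: KD.
Qed.

(** The ray to alpha stays within a bounded distance of the orbit. *)
Lemma boundary_reached x alpha :
  exists g, converges x (fun i => act (g i) x) alpha.
Proof.
have [D DP] := orbit_cobounded x.
have [g gP] := choice (fun n : nat => DP (ray_to x alpha n%:R)).
exists g; apply: converges_close (converges_ray x alpha) => i.
rewrite metric_sym; exact: gP.
Qed.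

Lemma act_geodesic h x y c : is_geodesic mdist x y c ->
  is_geodesic mdist (act h x) (act h y) (fun t => act h (c t)).
Proof.
move=> [c0 cy cI]; rewrite /is_geodesic gact_isometry c0 cy.
by split=> // s t sI tI; rewrite gact_isometry cI.
Qed.

Lemma converges_act h x (u : nat -> X) alpha : converges x u alpha ->
  converges x (fun i => act h (u i)) (boundary_act act h alpha).
Proof.
move=> [K uK]; apply: (@converges_basepoint _ _ (act h x)).
exists K => r r0; apply: filterS (uK r r0) => i [ru rK].
rewrite gact_isometry; split=> //.
rewrite (geodesic_unique (segP _ _) (act_geodesic h (segP x (u i)))); last first.
  by rewrite gact_isometry !ltW.
have rayE : ray_to (act h x) (boundary_act act h alpha) r =
    ray_act act h (ray_to x alpha) r.
  apply: ray_toE (ltW r0) => /=; first by rewrite ray_to0.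
  by rewrite -boundary_actE endpoint_ray_to.
by rewrite rayE /= gact_isometry.
Qed.

End Actions.

(** * Extending the orbit map to the boundaries *)

Section TwoActions.
Context {R : realType} {G : groupType} {X Y : cat0Type R}.
Variables (actX : geometric_action G X) (actY : geometric_action G Y).
Variables (x0 : X) (y0 : Y).
Implicit Types (g : nat -> G) (h : G).

Definition extends (phi : boundary X -> boundary Y) : Prop :=
  forall g alpha, converges x0 (fun i => actX (g i) x0) alpha ->
    converges y0 (fun i => actY (g i) y0) (phi alpha).

(** Otherwise infinitely many g_n x0 lie in one ball, and along an ultrafilter
    they accumulate at some z.  Comparing with one of them, g_m x0, the elements
    g_n g_m^-1 move a point close to z to a point close to z, so they range over
    a finite set, and the g_n y0 take finitely many values. *)
Lemma escapes_transfer g : escapes y0 (fun i => actY (g i) y0) ->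
  escapes x0 (fun i => actX (g i) x0).
Proof.
move=> yoo r; apply: contrapT => /not_near_subseq[k kn kr].
have [U [UU sU]] := @ultraFilterLemma nat \oo _.
have in_ball n : cball x0 r (actX (g (k n)) x0) by rewrite /cball /= leNgt; exact/negP.
have [z kz] := ultra_compact_cvg UU (@cat0_proper _ _ x0 r) (nearW _ in_ball).
have [s s0 finF] := gact_proper actX z.
have near_z : \forall n \near U, mdist z (actX (g (k n)) x0) < s.
  by move/metricType_numDomainType.cvgrPdist_lt : kz; apply.
have [m /= mz] := filter_ex near_z.
have [M MP] := compact_mdist_bounded y0 (finite_compact
  (finite_image (fun f => actY (f * g (k m))%g y0) finF)).
have near_far : \forall n \near \oo, M < mdist y0 (actY (g (k n)) y0).
  exact: cvg_ge_infty kn _ (yoo M).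
have [n [/= nz nM]] := filter_ex (filterI near_z (sU _ near_far)).
have /MP : ((fun f => actY (f * g (k m))%g y0) @`
    [set f | (actX f @` cball z s) `&` cball z s !=set0]) (actY (g (k n)) y0);
  last by rewrite leNgt nM.
exists (g (k n) * (g (k m))^-1)%g; last by rewrite mulgVK.
exists (actX (g (k n)) x0); split; last exact: ltW.
exists (actX (g (k m)) x0); first exact: ltW.
by rewrite -gactM mulgVK.
Qed.

(** The limit of g_i y0 does not depend on the sequence: for a second sequence k
    with k_i x0 converging to the same point, the interleaving of g and k gives a
    Cauchy sequence in Y, whose limit is shared by its two halves. *)
Lemma cauchy_preserving_extends :
  (forall g, cone_cauchy x0 (fun i => actX (g i) x0) ->
             cone_cauchy y0 (fun i => actY (g i) y0)) ->
  exists phi, extends phi.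
Proof.
move=> H.
suff [phi phiP] : {phi : boundary X -> boundary Y & forall alpha g,
    converges x0 (fun i => actX (g i) x0) alpha ->
    converges y0 (fun i => actY (g i) y0) (phi alpha)}.
  by exists phi => g alpha; exact: phiP.
apply: (@choice _ _ (fun alpha beta => forall g,
    converges x0 (fun i => actX (g i) x0) alpha ->
    converges y0 (fun i => actY (g i) y0) beta)) => alpha.
have [g ga] := boundary_reached actX x0 alpha.
have mix k : converges x0 (fun i => actX (k i) x0) alpha ->
    exists beta, converges y0 (fun i => actY (g i) y0) beta /\
                 converges y0 (fun i => actY (k i) y0) beta.
  move=> ka; have := converges_interleave ga ka.
  rewrite -(interleave_comp (fun h => actX h x0)) => mixa.
  have /converges_cauchy[beta] : cone_cauchy y0 (fun i => actY (interleave g k i) y0).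
    by apply: H; apply/converges_cauchy; exists alpha.
  rewrite (interleave_comp (fun h => actY h y0)) => mixb.
  by exists beta; exact: interleave_converges.
have [beta [gb _]] := mix _ ga; exists beta => k /mix[beta' [gb' kb']].
by rewrite (converges_unique gb gb').
Qed.

(** If phi were discontinuous at alpha, there would be boundary points beta_n
    converging to alpha with phi beta_n outside a fixed neighbourhood of
    phi alpha.  An orbit point h_n x0 close to beta_n, with h_n y0 close to
    phi beta_n, would then contradict that h_n x0 converges to alpha. *)
Lemma extends_continuous (phi : boundary_at x0 -> boundary_at y0) :
  extends phi -> continuous phi.
Proof.
move=> phiP; apply: continuous_comp_initial => alpha B.
move=> /nbhs_bordificationP[r r0 rB].
apply: filterS (_ : nbhs alpha
  [set beta | cone_nbhd y0 (inr (phi alpha)) r 1 (inr (phi beta))]).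
  by move=> beta /rB.
apply: contrapT => nnear.
have e0 : 0 < 1 / 2 :> R by rewrite divr_gt0.
(* p n is the pair of beta_n and h_n. *)
have [p pP] : {p : nat -> boundary X * G & forall n,
    [/\ n.+1%:R < mdist x0 (actX (p n).2 x0),
        mdist (seg x0 (actX (p n).2 x0) n.+1%:R) (ray_to x0 alpha n.+1%:R) <= 2,
        mdist (seg y0 (actY (p n).2 y0) r) (ray_to y0 (phi (p n).1) r) < 1 / 2 &
        ~ mdist (ray_to y0 (phi alpha) r) (ray_to y0 (phi (p n).1) r) < 1]}.
  apply: (@choice _ _ (fun n (q : boundary X * G) =>
    [/\ n.+1%:R < mdist x0 (actX q.2 x0),
        mdist (seg x0 (actX q.2 x0) n.+1%:R) (ray_to x0 alpha n.+1%:R) <= 2,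
        mdist (seg y0 (actY q.2 y0) r) (ray_to y0 (phi q.1) r) < 1 / 2 &
        ~ mdist (ray_to y0 (phi alpha) r) (ray_to y0 (phi q.1) r) < 1])) => n.
  have n0 : 0 < n.+1%:R :> R by [].
  (* A point of the (n+1)-st neighbourhood of alpha violating continuity. *)
  have [beta [bn nb]] : exists beta : boundary X,
      mdist (ray_to x0 alpha n.+1%:R) (ray_to x0 beta n.+1%:R) < 1 /\
      ~ mdist (ray_to y0 (phi alpha) r) (ray_to y0 (phi beta) r) < 1.
    apply: contrapT => nbeta; apply: nnear.
    have near_alpha : nbhs alpha
        [set beta : boundary_at x0 | cone_nbhd x0 (inr alpha) n.+1%:R 1 (inr beta)].
      apply: (@initial_continuous _ _ (inr : boundary X -> bordification x0) alpha).
      by apply/nbhs_bordificationP; exists n.+1%:R.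
    apply: filterS near_alpha => beta /(cone_nbhd_inrP _ _ _ _ (ltW n0))[_ /= ab].
    apply: (cone_nbhd_inrP y0 (phi alpha) (inr (phi beta)) 1 (ltW r0)).2.
    by split=> //=; apply: contrapT => nab; apply: nbeta; exists beta.
  have [g gb] := boundary_reached actX x0 beta.
  have [i [[ni xi] [_ yi]]] := filter_ex (filterI
    (converges_lt gb (ltW n0) ltr01) (converges_lt (phiP _ _ gb) (ltW r0) e0)).
  exists (beta, g i); split=> //=.
  apply: le_trans (metric_triangle _ (ray_to x0 beta n.+1%:R) _) _.
  rewrite (metric_sym (ray_to x0 beta _)); lra.
have ga : converges x0 (fun n => actX (p n).2 x0) alpha.
  exists 2; apply: (@diagonal_bound _ _ _ _ (fun n => inl (actX (p n).2 x0))) => n.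
  by have [] := pP n.
have [n [_ nr]] := filter_ex (converges_lt (phiP _ _ ga) (ltW r0) e0).
have [_ _ nb] := pP n; apply.
apply: le_lt_trans (metric_triangle _ (seg y0 (actY (p n).2 y0) r) _) _.
rewrite (metric_sym (ray_to y0 (phi alpha) r)); lra.
Qed.

Lemma extends_equivariant phi : extends phi -> is_equivariant actX actY phi.
Proof.
move=> phiP h alpha; have [g ga] := boundary_reached actX x0 alpha.
have hga := phiP (fun i => h * g i)%g (boundary_act actX h alpha).
apply: (converges_unique (hga _)).
  have := converges_act actX h ga; congr (converges _ _ _).
  by apply/funext => i; rewrite gactM.
have := converges_act actY h (phiP _ _ ga); congr (converges _ _ _).
by apply/funext => i; rewrite gactM.
Qed.

(** Every subsequence of g_i x0 has a further subsequence converging to the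
    unique alpha with phi alpha = beta. *)
Lemma extends_reflects_convergence phi g beta : extends phi -> injective phi ->
  converges y0 (fun i => actY (g i) y0) beta ->
  exists alpha, converges x0 (fun i => actX (g i) x0) alpha.
Proof.
move=> phiP phi_inj gb.
have goo := escapes_transfer (converges_escapes gb).
have sub k : (forall n, (n <= k n)%N) -> exists2 k', (forall n, (n <= k' n)%N) &
    exists2 alpha, converges x0 (fun i => actX (g (k (k' i))) x0) alpha &
      phi alpha = beta.
  move=> kn.
  have kgoo : escapes x0 (fun i => actX (g (k i)) x0).
    by move=> r; exact: cvg_ge_infty kn _ (goo r).
  have [k' k'n [alpha ka]] := escapes_converging_subseq kgoo.
  exists k' => //; exists alpha => //.
  apply: converges_unique (phiP (fun i => g (k (k' i))) _ ka) _.
  apply: (converges_subseq (k := k \o k') _ gb).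
  by apply: cvg_ge_infty => n; exact: leq_trans (k'n n) (kn _).
have [_ _ [alpha _ ab]] := sub id leqnn.
exists alpha, 1 => r r0; apply: contrapT => /not_near_subseq[k kn kP].
have [k' k'n [alpha' ka' a'b]] := sub _ kn.
have aa' : alpha' = alpha by apply: phi_inj; rewrite ab.
rewrite aa' in ka'.
have [i [ri ra]] := filter_ex (converges_lt ka' (ltW r0) ltr01).
by apply: (kP (k' i)); split=> //; exact: ltW.
Qed.

End TwoActions.

Theorem theorem1p2 (R : realType) (G : groupType) (X Y : cat0Type R)
    (actX : geometric_action G X) (actY : geometric_action G Y)
    (x0 : X) (y0 : Y) :
  (forall g : nat -> G,
     cone_cauchy x0 (fun i => actX (g i) x0) <->
     cone_cauchy y0 (fun i => actY (g i) y0))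
  <->
  (exists phi : boundary_at x0 -> boundary_at y0,
     is_homeomorphism phi /\ is_equivariant actX actY phi /\
     is_continuous_extension actX actY phi).
Proof.
split=> [H|[phi [[_ [psi [phiK _ _]]] [_ [_ phi_ext]]]] g].
  have [phi phiP] := @cauchy_preserving_extends _ _ _ _ actX actY x0 y0 (fun g => (H g).1).
  have [psi psiP] := @cauchy_preserving_extends _ _ _ _ actY actX y0 x0 (fun g => (H g).2).
  have phiK : cancel phi psi.
    move=> alpha; have [g ga] := boundary_reached actX x0 alpha.
    exact: converges_unique (psiP _ _ (phiP _ _ ga)) ga.
  have psiK : cancel psi phi.
    move=> beta; have [g gb] := boundary_reached actY y0 beta.
    exact: converges_unique (phiP _ _ (psiP _ _ gb)) gb.
  have phi_cont : continuous (phi : boundary_at x0 -> boundary_at y0).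
    exact: extends_continuous phiP.
  exists phi; split; [split=> //|split].
  - by exists psi; split=> //; exact: extends_continuous psiP.
  - exact: extends_equivariant phiP.
  - by split=> // g alpha /converges_cvg/phiP/converges_cvg.
have phiP : extends actX actY x0 y0 phi.
  by move=> h alpha /converges_cvg/phi_ext/converges_cvg.
have phi_inj := can_inj phiK.
rewrite !converges_cauchy; split=> [[alpha ga]|[beta gb]].
  by exists (phi alpha); exact: phiP.
exact: extends_reflects_convergence phiP phi_inj gb.
Qed.
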